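(* Let $\psi:\mathbb{T}^2\to\mathbb{R}$ be a non-constant real eigenfunction of the Laplacian on the flat two-dimensional torus $\mathbb{T}^2$. Then $$\max_{x\in\mathbb{T}^2}\psi(x)=-\min_{x\in\mathbb{T}^2}\psi(x).$$
   Context: $\mathbb{T}^2=\mathbb{R}^2/\mathbb{Z}^2$ is the standard flat torus. A real eigenfunction is a smooth function $\psi:\mathbb{T}^2\to\mathbb{R}$, not identically zero, with $-\Delta\psi=\mu\psi$ for some real $\mu$; equivalently, for some integer $\lambda\ge 0$, $\psi$ is a real-valued linear combination of the exponentials $\exp(2\pi i(\nu_1x+\nu_2y))$ with $\nu\in\mathbb{Z}^2$, $\nu_1^2+\nu_2^2=\lambda$. *)

(* Defs.v *)
From Stdlib Require Import Reals.
From Coquelicot Require Import Coquelicot.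
Open Scope R_scope.

(* Functions on the torus T^2 = R^2/Z^2 are represented by their pullbacks
   to R^2, i.e. by the Z^2-periodic functions of two real variables. *)
Definition on_torus (f : R -> R -> R) : Prop :=
  forall (m n : Z) (x y : R), f (x + IZR m) (y + IZR n) = f x y.

(* [ex_diff_n f n x y] says that all iterated partial derivatives of [f] of
   order at most [n] exist and are continuous at [(x, y)]. *)
Definition smooth (f : R -> R -> R) : Prop :=
  forall (n : nat) (x y : R), ex_diff_n f n x y.

Definition laplacian (f : R -> R -> R) (x y : R) : R :=
  partial_derive 2 0 f x y + partial_derive 0 2 f x y.

Definition torus_eigenfunction (f : R -> R -> R) : Prop :=
  on_torus f /\ smooth f /\
  (exists x y : R, f x y <> 0) /\
  exists mu : R, forall x y : R, - laplacian f x y = mu * f x y.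

Definition constant_on_torus (f : R -> R -> R) : Prop :=
  exists c : R, forall x y : R, f x y = c.

(* For a periodic [f], the values on R^2 are the values on the torus, so
   these are the maximum and minimum over T^2. *)
Definition is_maximum (f : R -> R -> R) (M : R) : Prop :=
  (exists x y : R, f x y = M) /\ (forall x y : R, f x y <= M).

Definition is_minimum (f : R -> R -> R) (m : R) : Prop :=
  (exists x y : R, f x y = m) /\ (forall x y : R, m <= f x y).

(* Main.v *)
Require Import Defs.
From Stdlib Require Import Reals Lra Lia ZArith ClassicalEpsilon.
From Coquelicot Require Import Coquelicot.
Open Scope R_scope.

(** A non-constant eigenfunction [psi] is carried to [-psi] by a translation
    of the torus, so its minimum is minus its maximum; the maximum exists by
    compactness ([torus_maximum]).

    The frequencies [(m, n)] of [psi] all lie on one circle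
    [m ^ 2 + n ^ 2 = l] with [l > 0] ([eigenfunction_tcoef]).  Translation by
    [(s, t)] multiplies the Fourier mode of frequency [(m, n)] by
    [exp (2 i PI (m s + n t))], so it is enough to find [(s, t)] such that
    [2 (m s + n t)] is an odd integer for all [(m, n)] on the circle
    ([circle_half_turn]).  If [l] is odd, exactly one of [m], [n] is odd, and
    [(1/2, 1/2)] works.  If [l] is 2 modulo 4, both are odd, and [(1/2, 0)]
    works.  If [4] divides [l], both are even, and half of a vector that works
    for [l / 4] works for [l].

    The Fourier expansion of [psi] is not needed, only the uniqueness theorem:
    a continuous periodic function whose Fourier coefficients all vanish is
    zero.  It is applied to [psi (x + s) (y + t) + psi x y]
    ([eigenfunction_translate]).  For one variable, it is proved by testing a
    function that is positive at 0 against the powers of a trigonometric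
    polynomial that exceeds 1 near 0 and is bounded by 1 elsewhere
    ([fourier_not_pos_at_0]); on the torus, it follows by treating one
    variable at a time ([torus_fourier_uniqueness]). *)

(** * Integrals of continuous functions on the line *)

Lemma ex_RInt_cont (f : R -> R) (a b : R) :
  (forall x, continuous f x) -> ex_RInt f a b.
Proof. intros Hf; apply (@ex_RInt_continuous R_CompleteNormedModule); auto. Qed.

Lemma continuous_mulR (f g : R -> R) (x : R) :
  continuous f x -> continuous g x -> continuous (fun z => f z * g z) x.
Proof. exact (continuous_mult f g x). Qed.

Lemma continuous_shift (f : R -> R) (s : R) :
  (forall x, continuous f x) -> forall x, continuous (fun z => f (z + s)) x.
Proof.
  intros Hf x.
  apply (continuous_comp (fun z => z + s) f); [|apply Hf].
  apply (@ex_derive_continuous R_AbsRing R_NormedModule); auto_derive; auto.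
Qed.

Lemma RInt_lincomb (f g : R -> R) (c d a b : R) :
  (forall x, continuous f x) -> (forall x, continuous g x) ->
  RInt (fun x => c * f x + d * g x) a b = c * RInt f a b + d * RInt g a b.
Proof.
  intros Hf Hg.
  pose proof (ex_RInt_cont f a b Hf) as If.
  pose proof (ex_RInt_cont g a b Hg) as Ig.
  apply (@is_RInt_unique R_CompleteNormedModule).
  apply (@is_RInt_plus R_NormedModule); apply (@is_RInt_scal R_NormedModule);
    apply (@RInt_correct R_CompleteNormedModule); assumption.
Qed.

Lemma RInt_translate (f : R -> R) (s a b : R) :
  (forall x, continuous f x) ->
  RInt (fun x => f (x + s)) a b = RInt f (a + s) (b + s).
Proof.
  intros Hf.
  pose proof (@RInt_comp_lin R_CompleteNormedModule f 1 s a b) as H.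
  replace (1 * a + s) with (a + s) in H by ring.
  replace (1 * b + s) with (b + s) in H by ring.
  rewrite <- H by (apply ex_RInt_cont; auto).
  apply (@RInt_ext R_CompleteNormedModule); intros x _.
  change (f (x + s) = 1 * f (1 * x + s)).
  rewrite Rmult_1_l; f_equal; ring.
Qed.

Lemma RInt_split (f : R -> R) (a b c : R) :
  (forall x, continuous f x) -> RInt f a b + RInt f b c = RInt f a c.
Proof.
  intros Hf.
  apply (@RInt_Chasles R_CompleteNormedModule); apply ex_RInt_cont; auto.
Qed.

Lemma RInt_period (f : R -> R) (s : R) :
  (forall x, continuous f x) -> (forall x, f (x + 1) = f x) ->
  RInt f s (s + 1) = RInt f 0 1.
Proof.
  intros Hf Hp.
  assert (H : RInt f (0 + 1) (s + 1) = RInt f 0 s).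
  { rewrite <- RInt_translate by exact Hf.
    apply (@RInt_ext R_CompleteNormedModule); intros x _; apply Hp. }
  rewrite Rplus_0_l in H.
  pose proof (RInt_split f 0 s (s + 1) Hf).
  pose proof (RInt_split f 0 1 (s + 1) Hf). lra.
Qed.

(** * Real Fourier coefficients in one variable *)

Lemma cos_add_PI_IZR (x : R) (k : Z) :
  cos (x + IZR k * PI) = (if Z.even k then 1 else -1) * cos x.
Proof.
  assert (S : forall j : Z, sin (IZR j * PI) = 0)
    by (intros j; apply sin_eq_0_1; exists j; reflexivity).
  assert (C : forall j : Z, cos (2 * (IZR j * PI)) = 1).
  { intros j; rewrite cos_2a_sin, S; ring. }
  rewrite cos_plus, S, Rmult_0_r, Rminus_0_r, Rmult_comm; f_equal.
  destruct (Z.even k) eqn:E.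
  - apply Z.even_spec in E; destruct E as [j ->].
    rewrite mult_IZR, Rmult_assoc; apply C.
  - assert (O : Z.odd k = true) by (rewrite <- Z.negb_even, E; reflexivity).
    apply Z.odd_spec in O; destruct O as [j ->].
    rewrite plus_IZR, mult_IZR.
    replace ((2 * IZR j + 1) * PI) with (2 * (IZR j * PI) + PI) by ring.
    rewrite neg_cos, C; ring.
Qed.

(** The mode of frequency [m] and phase [a].  An arbitrary real phase covers the
    cosine and the sine at once, and makes translations act on the phase. *)
Definition wave (m : Z) (a x : R) : R := cos (2 * PI * IZR m * x + a).

Lemma is_derive_wave (m : Z) (a x : R) :
  is_derive (wave m a) x (- (2 * PI * IZR m) * sin (2 * PI * IZR m * x + a)).
Proof. unfold wave; auto_derive; auto; ring. Qed.

Lemma continuous_wave (m : Z) (a x : R) : continuous (wave m a) x.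
Proof.
  apply (@ex_derive_continuous R_AbsRing R_NormedModule).
  eexists; apply is_derive_wave.
Qed.

Lemma wave_period (m : Z) (a x : R) : wave m a (x + 1) = wave m a x.
Proof.
  unfold wave.
  replace (2 * PI * IZR m * (x + 1) + a)
    with (2 * PI * IZR m * x + a + IZR (2 * m) * PI)
    by (rewrite mult_IZR; ring).
  rewrite cos_add_PI_IZR, Z.even_mul; simpl; ring.
Qed.

Lemma wave_shift (m : Z) (a s x : R) :
  wave m (a - 2 * PI * IZR m * s) (x + s) = wave m a x.
Proof. unfold wave; f_equal; ring. Qed.

Lemma wave_mult (m n : Z) (a b x : R) :
  wave m a x * wave n b x =
  / 2 * wave (m + n) (a + b) x + / 2 * wave (m - n) (a - b) x.
Proof.
  unfold wave; rewrite plus_IZR, minus_IZR.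
  set (p := 2 * PI * IZR m * x + a); set (q := 2 * PI * IZR n * x + b).
  replace (2 * PI * (IZR m + IZR n) * x + (a + b)) with (p + q)
    by (unfold p, q; ring).
  replace (2 * PI * (IZR m - IZR n) * x + (a - b)) with (p - q)
    by (unfold p, q; ring).
  rewrite cos_plus, cos_minus; field.
Qed.

(** The Fourier coefficient of a 1-periodic function against [wave m a]. *)
Definition fcoef (f : R -> R) (m : Z) (a : R) : R :=
  RInt (fun x => f x * wave m a x) 0 1.

(** Scalar multiples are the case [d = 0]. *)
Lemma fcoef_lincomb (f g : R -> R) (c d : R) (m : Z) (a : R) :
  (forall x, continuous f x) -> (forall x, continuous g x) ->
  fcoef (fun x => c * f x + d * g x) m a = c * fcoef f m a + d * fcoef g m a.
Proof.
  intros Hf Hg; unfold fcoef.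
  rewrite <- RInt_lincomb
    by (intros; apply continuous_mulR; auto using continuous_wave).
  apply (@RInt_ext R_CompleteNormedModule); intros x _; simpl; ring.
Qed.

Lemma fcoef_ext (f g : R -> R) (m : Z) (a : R) :
  (forall x, f x = g x) -> fcoef f m a = fcoef g m a.
Proof.
  intros H; apply (@RInt_ext R_CompleteNormedModule); intros x _; now rewrite H.
Qed.

Lemma fcoef_shift (f : R -> R) (s : R) (m : Z) (a : R) :
  (forall x, continuous f x) -> (forall x, f (x + 1) = f x) ->
  fcoef (fun x => f (x + s)) m a = fcoef f m (a - 2 * PI * IZR m * s).
Proof.
  intros Hf Hp; unfold fcoef.
  set (F := fun x => f x * wave m (a - 2 * PI * IZR m * s) x).
  assert (CF : forall x, continuous F x)
    by (intros; apply continuous_mulR; auto using continuous_wave).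
  transitivity (RInt (fun x => F (x + s)) 0 1).
  { apply (@RInt_ext R_CompleteNormedModule); intros x _.
    unfold F; now rewrite wave_shift. }
  rewrite RInt_translate by exact CF.
  replace (0 + s) with s by ring; replace (1 + s) with (s + 1) by ring.
  apply RInt_period; [exact CF|].
  intros x; unfold F; now rewrite Hp, wave_period.
Qed.

(** Two integrations by parts over a period, where the boundary terms cancel. *)
Lemma fcoef_second_derivative (f f1 f2 : R -> R) (m : Z) (a : R) :
  (forall x, is_derive f x (f1 x)) -> (forall x, is_derive f1 x (f2 x)) ->
  (forall x, continuous f2 x) ->
  (forall x, f (x + 1) = f x) -> (forall x, f1 (x + 1) = f1 x) ->
  fcoef f2 m a = - (2 * PI * IZR m) ^ 2 * fcoef f m a.
Proof.
  intros D1 D2 C2 P0 P1.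
  assert (C0 : forall x, continuous f x)
    by (intros x; apply (@ex_derive_continuous R_AbsRing R_NormedModule);
        eexists; apply D1).
  set (w := 2 * PI * IZR m).
  (* [W] is [f1 * wave - f * wave'], so its derivative is
     [f2 * wave - f * wave'']. *)
  set (W := fun x => f1 x * wave m a x + w * (f x * sin (w * x + a))).
  set (dW := fun x => 1 * (f2 x * wave m a x) + w ^ 2 * (f x * wave m a x)).
  assert (HW : is_RInt dW 0 1 (minus (W 1) (W 0))).
  { apply (@is_RInt_derive R_CompleteNormedModule).
    - intros x _; unfold W, dW.
      pose proof (D1 x) as E1; pose proof (D2 x) as E2.
      unfold wave; auto_derive.
      + split; [eexists; exact E2 | split; [eexists; exact E1 | auto]].
      + apply is_derive_unique in E1; apply is_derive_unique in E2.
        replace (Derive (fun z : R => f1 z) x) with (f2 x) by (symmetry; exact E2).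
        replace (Derive (fun z : R => f z) x) with (f1 x) by (symmetry; exact E1).
        fold w; ring.
    - intros x _; unfold dW.
      apply (@continuous_plus _ R_AbsRing R_NormedModule);
        apply continuous_mulR; try apply continuous_const;
        apply continuous_mulR; auto using continuous_wave. }
  apply (@is_RInt_unique R_CompleteNormedModule) in HW.
  unfold dW in HW.
  rewrite RInt_lincomb in HW
    by (intros; apply continuous_mulR; auto using continuous_wave).
  assert (HW0 : W 1 = W 0).
  { unfold W.
    replace 1 with (0 + 1) by ring.
    rewrite P0, P1, wave_period.
    (* The sine in [W] is the wave of phase [a - PI / 2]. *)
    pose proof (wave_period m (a - PI / 2) 0) as E; unfold wave in E.
    fold w in E.
    replace (w * (0 + 1) + (a - PI / 2))
      with (- (PI / 2 - (w * (0 + 1) + a))) in E by ring.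
    replace (w * 0 + (a - PI / 2))
      with (- (PI / 2 - (w * 0 + a))) in E by ring.
    rewrite !cos_neg, !cos_shift in E.
    now rewrite E. }
  rewrite HW0 in HW.
  change (minus (W 0) (W 0)) with (W 0 - W 0) in HW.
  unfold fcoef; lra.
Qed.

(** * The uniqueness theorem in one variable *)

Lemma continuous_pow (f : R -> R) (N : nat) (x : R) :
  continuous f x -> continuous (fun z => f z ^ N) x.
Proof.
  intros Hf; induction N as [|N IH]; simpl.
  - apply continuous_const.
  - now apply continuous_mulR.
Qed.

(** Functions with vanishing Fourier coefficients are stable under
    multiplication by trigonometric polynomials, since a product of two waves
    is a sum of two waves. *)
Lemma fcoef_zero_mult_pow (f : R -> R) (c : R) (N : nat) :
  (forall x, continuous f x) -> (forall m a, fcoef f m a = 0) ->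
  forall m a, fcoef (fun x => f x * (c + wave 1 0 x) ^ N) m a = 0.
Proof.
  intros Hf Z0.
  assert (CN : forall n x, continuous (fun z => f z * (c + wave 1 0 z) ^ n) x).
  { intros n x; apply continuous_mulR; [apply Hf|].
    apply continuous_pow, (@continuous_plus _ R_AbsRing R_NormedModule);
      [apply continuous_const | apply continuous_wave]. }
  induction N as [|N IH]; intros m a.
  - rewrite <- (Z0 m a); apply fcoef_ext; intros x; simpl; ring.
  - set (g := fun x => f x * (c + wave 1 0 x) ^ N) in *.
    assert (Cg : forall k b x, continuous (fun z => g z * wave k b z) x)
      by (intros; apply continuous_mulR; [apply CN | apply continuous_wave]).
    transitivity (1 * RInt (fun x => c * (g x * wave m a x) +
        / 2 * (g x * wave (1 + m) (0 + a) x)) 0 1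
      + / 2 * fcoef g (1 - m) (0 - a)).
    + unfold fcoef; rewrite <- RInt_lincomb; [| |auto].
      * apply (@RInt_ext R_CompleteNormedModule); intros x _.
        pose proof (wave_mult 1 m 0 a x) as E.
        (* [ring] needs the equality to be stated at type [R]. *)
        match goal with |- _ = ?r =>
          change (@eq R (f x * (c + wave 1 0 x) ^ S N * wave m a x) r)
        end.
        unfold g; rewrite <- tech_pow_Rmult.
        transitivity (f x * (c + wave 1 0 x) ^ N *
          (c * wave m a x + wave 1 0 x * wave m a x)); [|rewrite E]; ring.
      * intros x; apply (@continuous_plus _ R_AbsRing R_NormedModule);
          apply continuous_mulR; auto; apply continuous_const.
    + rewrite RInt_lincomb by auto.
      change (1 * (c * fcoef g m a + / 2 * fcoef g (1 + m) (0 + a))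
        + / 2 * fcoef g (1 - m) (0 - a) = 0).
      rewrite !IH; ring.
Qed.

Lemma RInt_ge_const (f : R -> R) (a b c : R) :
  (forall x, continuous f x) -> a <= b -> (forall x, a <= x <= b -> c <= f x) ->
  c * (b - a) <= RInt f a b.
Proof.
  intros Hf Hab Hc.
  pose proof (RInt_const (V := R_CompleteNormedModule) a b c) as E.
  change (scal (b - a) c) with ((b - a) * c) in E.
  rewrite Rmult_comm, <- E.
  apply RInt_le; auto using ex_RInt_cont.
  - apply (@ex_RInt_const R_NormedModule).
  - intros; apply Hc; lra.
Qed.

Lemma fourier_not_pos_at_0 (f : R -> R) :
  (forall x, continuous f x) -> (forall x, f (x + 1) = f x) ->
  (forall m a, fcoef f m a = 0) -> ~ 0 < f 0.
Proof.
  intros Hf Hp Z0 Hpos.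
  assert (Hd : exists d, 0 < d < 1 / 2 /\
    forall x, Rabs x <= d -> f 0 / 2 <= f x).
  { assert (e : 0 < f 0 / 2) by lra.
    pose proof (proj1 (filterlim_locally f (f 0)) (Hf 0) (mkposreal _ e))
      as [d Hd].
    exists (Rmin (d / 2) (1 / 4)); split.
    - pose proof (cond_pos d).
      split; [apply Rmin_glb_lt; lra|].
      pose proof (Rmin_r (d / 2) (1 / 4)); lra.
    - intros x Hx.
      pose proof (Rmin_l (d / 2) (1 / 4)); pose proof (cond_pos d).
      assert (B : ball (f 0) (f 0 / 2) (f x)).
      { apply Hd. change (Rabs (x - 0) < d). rewrite Rminus_0_r; lra. }
      change (Rabs (f x - f 0) < f 0 / 2) in B.
      apply Rabs_def2 in B; lra. }
  destruct Hd as [d [Hd Hfd]].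
  assert (HM : exists M, 0 < M /\
    forall x, - (1 / 2) <= x <= 1 / 2 -> Rabs (f x) <= M).
  { destruct (continuity_ab_maj (fun x => Rabs (f x)) (- (1 / 2)) (1 / 2))
      as [x0 [H0 _]]; [lra| |].
    - intros x _; apply (continuity_pt_comp f Rabs); [|apply Rcontinuity_abs].
      apply continuity_pt_filterlim, Hf.
    - exists (Rabs (f x0) + 1); split; [pose proof (Rabs_pos (f x0)); lra|].
      intros x Hx; specialize (H0 x Hx); simpl in H0; lra. }
  destruct HM as [M [HM0 HM]].
  pose proof PI_RGT_0 as Hpi.
  (* [p] is at least 1 exactly on [[-d, d]], at least [1 + q] on
     [[-d/2, d/2]], and lies in [[-1, 1]] on the rest of the period. *)
  set (c := 1 - cos (2 * PI * d)).
  set (p := fun x => c + wave 1 0 x).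
  assert (Ep : forall x, p x = 1 + (cos (2 * PI * Rabs x) - cos (2 * PI * d))).
  { intros x; unfold p, c, wave.
    replace (cos (2 * PI * Rabs x)) with (cos (2 * PI * 1 * x + 0)); [ring|].
    unfold Rabs; destruct (Rcase_abs x); [rewrite <- cos_neg|]; f_equal; ring. }
  assert (Hin : forall x, Rabs x <= d -> 1 <= p x).
  { intros x Hx; rewrite Ep; pose proof (Rabs_pos x).
    assert (cos (2 * PI * d) <= cos (2 * PI * Rabs x)); [|lra].
    apply cos_decr_1; nra. }
  set (q := cos (2 * PI * (d / 2)) - cos (2 * PI * d)).
  assert (Hq : 0 < q).
  { unfold q.
    assert (cos (2 * PI * d) < cos (2 * PI * (d / 2))); [|lra].
    apply cos_decreasing_1; nra. }
  assert (Hin2 : forall x, Rabs x <= d / 2 -> 1 + q <= p x).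
  { intros x Hx; rewrite Ep; unfold q; pose proof (Rabs_pos x).
    assert (cos (2 * PI * (d / 2)) <= cos (2 * PI * Rabs x)); [|lra].
    apply cos_decr_1; nra. }
  assert (Hout : forall x, d <= Rabs x <= 1 / 2 -> Rabs (p x) <= 1).
  { intros x Hx; rewrite Ep; apply Rabs_le.
    assert (cos (2 * PI * Rabs x) <= cos (2 * PI * d))
      by (apply cos_decr_1; nra).
    pose proof (COS_bound (2 * PI * Rabs x)); pose proof (COS_bound (2 * PI * d)).
    lra. }
  (* On [[-d, d]] both factors are nonnegative; outside, [p] is at most 1 in
     absolute value. *)
  assert (Hlow : forall N x, - (1 / 2) <= x <= 1 / 2 -> - M <= f x * p x ^ N).
  { intros N x Hx.
    destruct (Rle_dec (Rabs x) d) as [Hxd|Hxd].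
    - pose proof (Hfd x Hxd); pose proof (Hin x Hxd).
      assert (0 <= p x ^ N) by (apply pow_le; lra). nra.
    - assert (Hx2 : d <= Rabs x <= 1 / 2)
        by (split; [lra | apply Rabs_le; lra]).
      assert (B : Rabs (f x * p x ^ N) <= M * 1).
      { rewrite Rabs_mult; apply Rmult_le_compat; auto using Rabs_pos.
        rewrite <- RPow_abs, <- (pow1 N).
        apply pow_incr; split; auto using Rabs_pos. }
      apply Rabs_le_between in B; lra. }
  assert (CN : forall N x, continuous (fun z => f z * p z ^ N) x).
  { intros n x; apply continuous_mulR; [apply Hf|].
    apply continuous_pow, (@continuous_plus _ R_AbsRing R_NormedModule);
      [apply continuous_const | apply continuous_wave]. }
  (* The integral of [f * p ^ N] over the period is 0, whereas [[-d/2, d/2]]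
     contributes at least [f 0 / 2 * (1 + q) ^ N * d] and the rest at least
     [- M]. *)
  assert (Hmain : forall N, f 0 / 2 * (1 + q) ^ N * d <= M).
  { intros N.
    set (F := fun x => f x * p x ^ N).
    assert (CF : forall x, continuous F x) by apply CN.
    assert (I0 : RInt F (- (1 / 2)) (1 / 2) = 0).
    { replace (1 / 2) with (- (1 / 2) + 1) at 2 by lra.
      rewrite RInt_period; [|exact CF|].
      - etransitivity; [|exact (fcoef_zero_mult_pow f c N Hf Z0 0%Z 0)].
        apply (@RInt_ext R_CompleteNormedModule); intros x _.
        assert (E : wave 0 0 x = 1).
        { unfold wave; rewrite <- cos_0; f_equal; ring. }
        rewrite E; symmetry; apply Rmult_1_r.
      - intros x; unfold F, p; now rewrite Hp, wave_period. }
    pose proof (RInt_split F (- (1 / 2)) (- (d / 2)) (1 / 2) CF).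
    pose proof (RInt_split F (- (d / 2)) (d / 2) (1 / 2) CF).
    assert (J1 : - M * (- (d / 2) - - (1 / 2)) <= RInt F (- (1 / 2)) (- (d / 2)))
      by (apply RInt_ge_const; [exact CF | lra | intros; apply Hlow; lra]).
    assert (J3 : - M * (1 / 2 - d / 2) <= RInt F (d / 2) (1 / 2))
      by (apply RInt_ge_const; [exact CF | lra | intros; apply Hlow; lra]).
    assert (J2 : f 0 / 2 * (1 + q) ^ N * (d / 2 - - (d / 2))
      <= RInt F (- (d / 2)) (d / 2)).
    { apply RInt_ge_const; [exact CF | lra |]; intros x Hx.
      assert (Hx2 : Rabs x <= d / 2) by (apply Rabs_le; lra).
      apply Rmult_le_compat; [lra | apply pow_le; lra | apply Hfd; lra |].
      apply pow_incr; specialize (Hin2 x Hx2); lra. }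
    nra. }
  assert (A : 0 < f 0 / 2 * q * d) by (repeat apply Rmult_lt_0_compat; lra).
  (* By Bernoulli's inequality [(1 + q) ^ N] is unbounded. *)
  destruct (INR_archimed (f 0 / 2 * q * d) M A) as [N HN].
  pose proof (Hmain N) as B; pose proof (poly N q Hq) as C.
  assert (f 0 / 2 * d * (1 + INR N * q) <= f 0 / 2 * d * (1 + q) ^ N)
    by (apply Rmult_le_compat_l; nra).
  nra.
Qed.

(** The positivity statement at 0 is applied to the translates of [f] and of
    [-f]. *)
Lemma fourier_uniqueness (f : R -> R) :
  (forall x, continuous f x) -> (forall x, f (x + 1) = f x) ->
  (forall m a, fcoef f m a = 0) -> forall x, f x = 0.
Proof.
  intros Hf Hp Z0 x.
  assert (G : forall e, ~ 0 < e * f (0 + x)).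
  { intros e.
    apply (fourier_not_pos_at_0 (fun z => e * f (z + x))).
    - intros z; apply continuous_mulR; [apply continuous_const|].
      now apply continuous_shift.
    - intros z; now replace (z + 1 + x) with (z + x + 1) by ring; rewrite Hp.
    - intros m a.
      rewrite (fcoef_ext _ (fun z => e * f (z + x) + 0 * f (z + x)))
        by (intros; ring).
      rewrite fcoef_lincomb by (apply continuous_shift; exact Hf).
      rewrite fcoef_shift, Z0 by assumption; ring. }
  rewrite Rplus_0_l in G.
  pose proof (G 1); pose proof (G (-1)); lra.
Qed.

(** * Joint continuity and coefficients depending on a parameter *)

Lemma continuity_2d_pt_swap (f : R -> R -> R) (x y : R) :
  continuity_2d_pt f x y -> continuity_2d_pt (fun u v => f v u) y x.
Proof. intros H eps; destruct (H eps) as [d Hd]; exists d; auto. Qed.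

Lemma continuity_2d_pt_translate (f : R -> R -> R) (s t : R) :
  (forall x y, continuity_2d_pt f x y) ->
  forall x y, continuity_2d_pt (fun u v => f (u + s) (v + t)) x y.
Proof.
  intros H x y eps; destruct (H (x + s) (y + t) eps) as [d Hd].
  exists d; intros u v Hu Hv; apply Hd;
    [replace (u + s - (x + s)) with (u - x) by ring
    |replace (v + t - (y + t)) with (v - y) by ring]; assumption.
Qed.

Lemma continuity_2d_pt_fst (f : R -> R -> R) (y : R) :
  (forall x y, continuity_2d_pt f x y) -> forall x, continuous (fun z => f z y) x.
Proof.
  intros H x; apply filterlim_locally; intros eps.
  destruct (H x y eps) as [d Hd]; exists d; intros z Hz.
  apply Hd; [exact Hz|].
  rewrite Rminus_diag, Rabs_R0; apply cond_pos.
Qed.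

Lemma continuity_2d_pt_snd (f : R -> R -> R) (x : R) :
  (forall x y, continuity_2d_pt f x y) -> forall y, continuous (f x) y.
Proof.
  intros H; apply (continuity_2d_pt_fst (fun u v => f v u)).
  intros u v; now apply continuity_2d_pt_swap.
Qed.

Lemma continuity_2d_pt_mult_fst (f : R -> R -> R) (w : R -> R) :
  (forall x y, continuity_2d_pt f x y) -> (forall x, continuous w x) ->
  forall x y, continuity_2d_pt (fun u v => f u v * w u) x y.
Proof.
  intros Hf Hw x y; apply continuity_2d_pt_mult; [apply Hf|].
  apply (continuity_1d_2d_pt_comp w (fun u _ => u)).
  - apply continuity_pt_filterlim, Hw.
  - apply continuity_2d_pt_id1.
Qed.

Lemma continuous_fcoef_param (f : R -> R -> R) (m : Z) (a : R) :
  (forall x y, continuity_2d_pt f x y) ->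
  forall y, continuous (fun v => fcoef (fun u => f u v) m a) y.
Proof.
  intros Hf y.
  set (g := fun u v => f u v * wave m a u).
  assert (Hg : forall x y, continuity_2d_pt g x y)
    by (apply continuity_2d_pt_mult_fst; auto using continuous_wave).
  apply filterlim_locally; intros eps.
  assert (e2 : 0 < eps / 2) by (pose proof (cond_pos eps); lra).
  destruct (uniform_continuity_2d_1d g 0 1 y (fun x _ => Hg x y)
    (mkposreal _ e2)) as [d Hd]; simpl in Hd.
  exists d; intros v Hv; change (Rabs (v - y) < d) in Hv.
  change (Rabs (RInt (fun u => g u v) 0 1 - RInt (fun u => g u y) 0 1) < eps).
  assert (Cg : forall v x, continuous (fun u => g u v) x)
    by (intros; now apply continuity_2d_pt_fst).
  replace (RInt (fun u => g u v) 0 1 - RInt (fun u => g u y) 0 1)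
    with (RInt (fun u => 1 * g u v + -1 * g u y) 0 1)
    by (rewrite RInt_lincomb by apply Cg;
        match goal with |- ?l = ?r => change (@eq R l r) end; ring).
  apply Rle_lt_trans with ((1 - 0) * (eps / 2)); [|lra].
  apply abs_RInt_le_const; [lra| |].
  - apply ex_RInt_cont; intros x.
    apply (@continuous_plus _ R_AbsRing R_NormedModule); apply continuous_mulR;
      auto; apply continuous_const.
  - intros x Hx.
    replace (1 * g x v + -1 * g x y) with (g x v - g x y) by ring.
    apply Rlt_le, Hd; auto.
    + pose proof (cond_pos d); lra.
    + apply Rabs_def2 in Hv; lra.
    + rewrite Rminus_diag, Rabs_R0; apply cond_pos.
Qed.

Lemma is_derive_fcoef_param (f : R -> R -> R) (m : Z) (a : R) :
  (forall x y, continuity_2d_pt f x y) ->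
  (forall x y, ex_derive (fun z => f x z) y) ->
  (forall x y, continuity_2d_pt (fun u v => Derive (fun z => f u z) v) x y) ->
  forall y, is_derive (fun v => fcoef (fun u => f u v) m a) y
    (fcoef (fun u => Derive (fun z => f u z) y) m a).
Proof.
  intros Cf Df Cdf y.
  assert (E : forall u v, Derive (fun z => f u z * wave m a u) v =
    Derive (fun z => f u z) v * wave m a u) by (intros; apply Derive_scal_l).
  pose proof (is_derive_RInt_param (fun v u => f u v * wave m a u) 0 1 y) as H.
  unfold fcoef.
  rewrite (@RInt_ext R_CompleteNormedModule _
    (fun u => Derive (fun z => f u z * wave m a u) y)).
  - apply H.
    + exists (mkposreal 1 Rlt_0_1); intros v _ u _.
      apply (ex_derive_mult (fun z => f u z) (fun _ => wave m a u));
        [apply Df | apply ex_derive_const].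
    + intros u _.
      apply (continuity_2d_pt_ext
        (fun v u => Derive (fun z => f u z) v * wave m a u)).
      * intros v w; symmetry; apply E.
      * apply (continuity_2d_pt_swap
          (fun u v => Derive (fun z => f u z) v * wave m a u)).
        apply (continuity_2d_pt_mult_fst (fun u v => Derive (fun z => f u z) v));
          auto using continuous_wave.
    + exists (mkposreal 1 Rlt_0_1); intros v _.
      apply ex_RInt_cont; intros x; apply continuous_mulR;
        [now apply continuity_2d_pt_fst | apply continuous_wave].
  - intros u _; symmetry; apply E.
Qed.

(** * Fourier coefficients on the torus *)

(** The Fourier coefficient of [f] against [wave m a x * wave n b y], as an
    iterated integral. *)
Definition tcoef (f : R -> R -> R) (m : Z) (a : R) (n : Z) (b : R) : R :=
  fcoef (fun y => fcoef (fun x => f x y) m a) n b.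

Lemma on_torus_fst (f : R -> R -> R) :
  on_torus f -> forall x y, f (x + 1) y = f x y.
Proof. intros H x y; rewrite <- (H 1%Z 0%Z x y); now rewrite Rplus_0_r. Qed.

Lemma on_torus_snd (f : R -> R -> R) :
  on_torus f -> forall x y, f x (y + 1) = f x y.
Proof. intros H x y; rewrite <- (H 0%Z 1%Z x y); now rewrite Rplus_0_r. Qed.

Lemma tcoef_lincomb (f g : R -> R -> R) (c d : R) (m : Z) (a : R) (n : Z) (b : R) :
  (forall x y, continuity_2d_pt f x y) -> (forall x y, continuity_2d_pt g x y) ->
  tcoef (fun x y => c * f x y + d * g x y) m a n b =
  c * tcoef f m a n b + d * tcoef g m a n b.
Proof.
  intros Hf Hg; unfold tcoef.
  rewrite <- fcoef_lincomb by (now apply continuous_fcoef_param).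
  apply fcoef_ext; intros y.
  apply fcoef_lincomb; now apply continuity_2d_pt_fst.
Qed.

Lemma tcoef_translate (f : R -> R -> R) (s t : R) (m : Z) (a : R) (n : Z) (b : R) :
  (forall x y, continuity_2d_pt f x y) -> on_torus f ->
  tcoef (fun x y => f (x + s) (y + t)) m a n b =
  tcoef f m (a - 2 * PI * IZR m * s) n (b - 2 * PI * IZR n * t).
Proof.
  intros Hf Hp; unfold tcoef.
  rewrite <- fcoef_shift with
    (f := fun y => fcoef (fun x => f x y) m (a - 2 * PI * IZR m * s)).
  - apply fcoef_ext; intros y.
    apply (fcoef_shift (fun x => f x (y + t))).
    + now apply continuity_2d_pt_fst.
    + intros x; now apply on_torus_fst.
  - now apply continuous_fcoef_param.
  - intros y; apply fcoef_ext; intros x; now apply on_torus_snd.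
Qed.

(** For fixed [m] and [a], the coefficient in [x] is a function of [y] with
    vanishing coefficients, hence zero; then each [f (., y)] is zero. *)
Lemma torus_fourier_uniqueness (f : R -> R -> R) :
  (forall x y, continuity_2d_pt f x y) -> on_torus f ->
  (forall m a n b, tcoef f m a n b = 0) -> forall x y, f x y = 0.
Proof.
  intros Hf Hp Z0 x y.
  apply (fourier_uniqueness (fun x => f x y)).
  - now apply continuity_2d_pt_fst.
  - intros u; now apply on_torus_fst.
  - intros m a.
    apply (fourier_uniqueness (fun y => fcoef (fun x => f x y) m a)).
    + now apply continuous_fcoef_param.
    + intros v; apply fcoef_ext; intros u; now apply on_torus_snd.
    + intros n b; exact (Z0 m a n b).
Qed.

Lemma Derive_period (f : R -> R) (x : R) :
  (forall z, f (z + 1) = f z) -> Derive f (x + 1) = Derive f x.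
Proof.
  intros Hp; unfold Derive; f_equal; apply Lim_ext; intros h.
  replace (x + 1 + h) with (x + h + 1) by ring; now rewrite !Hp.
Qed.

(** An eigenfunction of eigenvalue [mu] has frequencies [(m, n)] only on the
    circle [mu = (2 PI) ^ 2 (m ^ 2 + n ^ 2)]. *)
Lemma eigenfunction_tcoef (f : R -> R -> R) (mu : R) (m : Z) (a : R) (n : Z) (b : R) :
  on_torus f -> smooth f -> (forall x y, - laplacian f x y = mu * f x y) ->
  (mu - (2 * PI) ^ 2 * IZR (m * m + n * n)) * tcoef f m a n b = 0.
Proof.
  intros Hp Hs Hl.
  set (fx := fun u v => Derive (fun z => f z v) u).
  set (fy := fun u v => Derive (fun z => f u z) v).
  set (fxx := fun u v => Derive (fun z => fx z v) u).
  set (fyy := fun u v => Derive (fun z => fy u z) v).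
  assert (Cf : forall x y, continuity_2d_pt f x y) by apply (Hs 0%nat).
  assert (Cfxx : forall x y, continuity_2d_pt fxx x y) by apply (Hs 2%nat).
  assert (Cfy : forall x y, continuity_2d_pt fy x y) by apply (Hs 1%nat).
  assert (Cfyy : forall x y, continuity_2d_pt fyy x y) by apply (Hs 2%nat).
  assert (Dfx : forall x y, ex_derive (fun z => f z y) x) by apply (Hs 1%nat).
  assert (Dfy : forall x y, ex_derive (fun z => f x z) y) by apply (Hs 1%nat).
  assert (Dfxx : forall x y, ex_derive (fun z => fx z y) x) by apply (Hs 2%nat).
  assert (Dfyy : forall x y, ex_derive (fun z => fy x z) y) by apply (Hs 2%nat).
  assert (L : forall x y, fyy x y = - mu * f x y + -1 * fxx x y).
  { intros x y.
    assert (E : laplacian f x y = fxx x y + fyy x y) by reflexivity.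
    specialize (Hl x y); rewrite E in Hl; lra. }
  (* The coefficient [h y] in the variable [x] satisfies the ordinary
     differential equation [h'' = k h]. *)
  set (h := fun y => fcoef (fun x => f x y) m a).
  set (k := - mu + (2 * PI * IZR m) ^ 2).
  set (h2 := fun y => fcoef (fun x => fyy x y) m a).
  assert (Hh2 : forall y, h2 y = k * h y + 0 * h y).
  { intros y; unfold h2, k, h.
    rewrite (fcoef_ext _ _ m a (fun x => L x y)).
    rewrite fcoef_lincomb by (now apply continuity_2d_pt_fst).
    rewrite (fcoef_second_derivative (fun x => f x y) (fun x => fx x y)
      (fun x => fxx x y)).
    - ring.
    - intros x; apply Derive_correct, Dfx.
    - intros x; apply Derive_correct, Dfxx.
    - now apply continuity_2d_pt_fst.
    - intros x; now apply on_torus_fst.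
    - intros x; apply (Derive_period (fun z => f z y)).
      intros z; now apply on_torus_fst. }
  assert (Ch : forall y, continuous h y) by exact (continuous_fcoef_param f m a Cf).
  assert (E1 : fcoef h2 n b = k * fcoef h n b).
  { rewrite (fcoef_ext _ _ n b Hh2), fcoef_lincomb by exact Ch; ring. }
  rewrite (fcoef_second_derivative h (fun y => fcoef (fun x => fy x y) m a) h2)
    in E1.
  - unfold tcoef; fold h.
    rewrite plus_IZR, !mult_IZR.
    unfold k in E1. lra.
  - exact (is_derive_fcoef_param f m a Cf Dfy Cfy).
  - exact (is_derive_fcoef_param fy m a Cfy Dfyy Cfyy).
  - exact (continuous_fcoef_param fyy m a Cfyy).
  - intros y; unfold h; apply fcoef_ext.
    intros x; exact (on_torus_snd f Hp x y).
  - intros y; apply fcoef_ext; intros x.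
    exact (Derive_period (f x) y (on_torus_snd f Hp x)).
Qed.

(** * Translations acting on eigenfunctions *)

(** [(-1) ^ j]. *)
Definition parity_sign (j : Z) : R := if Z.even j then 1 else -1.

(** Translating by [s] with [2 m s = j] an integer rotates the phase by
    [- j * PI]. *)
Lemma wave_half_turn (m j : Z) (a s x : R) :
  2 * IZR m * s = IZR j -> wave m (a - 2 * PI * IZR m * s) x = parity_sign j * wave m a x.
Proof.
  intros H; unfold wave, parity_sign.
  replace (2 * PI * IZR m * x + (a - 2 * PI * IZR m * s))
    with (2 * PI * IZR m * x + a + IZR (- j) * PI).
  - rewrite cos_add_PI_IZR; now rewrite Z.even_opp.
  - rewrite opp_IZR, <- H; ring.
Qed.

Lemma fcoef_half_turn (f : R -> R) (m j : Z) (a s : R) :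
  (forall x, continuous f x) -> 2 * IZR m * s = IZR j ->
  fcoef f m (a - 2 * PI * IZR m * s) = parity_sign j * fcoef f m a.
Proof.
  intros Hf H.
  transitivity (parity_sign j * fcoef f m a + 0 * fcoef f m a); [|ring].
  rewrite <- fcoef_lincomb by exact Hf.
  apply (@RInt_ext R_CompleteNormedModule); intros x _.
  rewrite (wave_half_turn m j) by exact H.
  match goal with |- ?l = ?r => change (@eq R l r) end; ring.
Qed.

Lemma tcoef_half_turn (f : R -> R -> R) (s t : R) (m j n k : Z) (a b : R) :
  (forall x y, continuity_2d_pt f x y) -> on_torus f ->
  2 * IZR m * s = IZR j -> 2 * IZR n * t = IZR k ->
  tcoef (fun x y => f (x + s) (y + t)) m a n b = parity_sign (j + k) * tcoef f m a n b.
Proof.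
  intros Hf Hp Hj Hk; rewrite tcoef_translate by assumption; unfold tcoef.
  rewrite (fcoef_half_turn _ n k) by (auto; now apply continuous_fcoef_param).
  rewrite (fcoef_ext _ (fun y => parity_sign j * fcoef (fun x => f x y) m a
    + 0 * fcoef (fun x => f x y) m a)).
  - rewrite fcoef_lincomb by now apply continuous_fcoef_param.
    unfold parity_sign; rewrite Z.even_add.
    destruct (Z.even j), (Z.even k); simpl; ring.
  - intros y; rewrite (fcoef_half_turn _ m j); [ring| |exact Hj].
    now apply continuity_2d_pt_fst.
Qed.

(** If a translation multiplies all the modes on the circle of [mu] by the same
    sign [e], it multiplies every eigenfunction of eigenvalue [mu] by [e]. *)
Lemma eigenfunction_translate (f : R -> R -> R) (mu e s t : R) :
  on_torus f -> smooth f -> (forall x y, - laplacian f x y = mu * f x y) ->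
  (forall m n : Z, mu = (2 * PI) ^ 2 * IZR (m * m + n * n) ->
    exists j k, 2 * IZR m * s = IZR j /\ 2 * IZR n * t = IZR k /\
      parity_sign (j + k) = e) ->
  forall x y, f (x + s) (y + t) = e * f x y.
Proof.
  intros Hp Hs Hl Hst.
  assert (Cf : forall x y, continuity_2d_pt f x y) by apply (Hs 0%nat).
  pose proof (continuity_2d_pt_translate f s t Cf) as Cg.
  assert (G : forall x y, 1 * f (x + s) (y + t) + - e * f x y = 0).
  { apply torus_fourier_uniqueness.
    - intros x y; apply continuity_2d_pt_plus; apply continuity_2d_pt_mult;
        auto using continuity_2d_pt_const.
    - intros m n x y.
      replace (x + IZR m + s) with (x + s + IZR m) by ring.
      replace (y + IZR n + t) with (y + t + IZR n) by ring.
      now rewrite !Hp.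
    - intros m a n b.
      rewrite (tcoef_lincomb (fun x y => f (x + s) (y + t)) f) by assumption.
      destruct (Req_dec mu ((2 * PI) ^ 2 * IZR (m * m + n * n))) as [E|E].
      + destruct (Hst m n E) as (j & k & Hj & Hk & He).
        rewrite (tcoef_half_turn f s t m j n k) by assumption.
        rewrite He; ring.
      + assert (V : forall a b, tcoef f m a n b = 0).
        { intros a' b'.
          destruct (Rmult_integral _ _
            (eigenfunction_tcoef f mu m a' n b' Hp Hs Hl)); [lra|assumption]. }
        rewrite tcoef_translate, !V by assumption; ring. }
  intros x y; specialize (G x y); lra.
Qed.

(** The arithmetic of the circle [m ^ 2 + n ^ 2 = l]: one translation changes
    the sign of every mode on it.  The descent from [l] to [l / 4] halves the
    translation. *)
Lemma circle_half_turn (l : Z) : (0 < l)%Z ->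
  exists s t : R, forall m n : Z, (m * m + n * n = l)%Z ->
  exists j k : Z, 2 * IZR m * s = IZR j /\ 2 * IZR n * t = IZR k /\
    Z.odd (j + k) = true.
Proof.
  induction l as [l IH] using (well_founded_ind (Z.lt_wf 0)); intros Hl.
  (* A square is 0 or 1 modulo 4, according to parity. *)
  assert (Sq : forall m, exists q, (m * m = 4 * q + (if Z.odd m then 1 else 0))%Z).
  { intros m; destruct (Z.odd m) eqn:E.
    - apply Z.odd_spec in E; destruct E as [i ->]; exists (i * i + i)%Z; ring.
    - assert (E' : Z.even m = true) by (rewrite <- Z.negb_odd, E; reflexivity).
      apply Z.even_spec in E'; destruct E' as [i ->]; exists (i * i)%Z; ring. }
  pose proof (Z.div_mod l 4 ltac:(lia)) as D.
  pose proof (Z.mod_pos_bound l 4 ltac:(lia)) as B.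
  destruct (Z.eq_dec (l mod 4) 0) as [E0|E0].
  - destruct (IH (l / 4)%Z) as (s & t & H); [lia | lia |].
    exists (s / 2), (t / 2); intros m n Hmn.
    destruct (Sq m) as [q1 H1], (Sq n) as [q2 H2].
    assert (Emn : Z.odd m = false /\ Z.odd n = false)
      by (destruct (Z.odd m), (Z.odd n); auto; lia).
    destruct Emn as [Em En].
    rewrite <- Z.negb_even, Bool.negb_false_iff in Em, En.
    apply Z.even_spec in Em; apply Z.even_spec in En.
    destruct Em as [m' Em], En as [n' En]; subst m n.
    destruct (H m' n') as (j & k & Hj & Hk & Ho); [nia|].
    exists j, k; rewrite !mult_IZR; repeat split; [lra | lra | exact Ho].
  - destruct (Z.eq_dec (l mod 4) 2) as [E2|E2].
    + exists (1 / 2), 0; intros m n Hmn; exists m, 0%Z.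
      destruct (Sq m) as [q1 H1], (Sq n) as [q2 H2].
      repeat split; [lra | lra |].
      rewrite Z.add_0_r; destruct (Z.odd m), (Z.odd n); auto; lia.
    + exists (1 / 2), (1 / 2); intros m n Hmn; exists m, n.
      destruct (Sq m) as [q1 H1], (Sq n) as [q2 H2].
      repeat split; [lra | lra |].
      rewrite Z.odd_add; destruct (Z.odd m), (Z.odd n); auto; lia.
Qed.

(** Every non-constant eigenfunction changes sign under some translation. *)
Lemma eigenfunction_antiperiod (f : R -> R -> R) :
  torus_eigenfunction f -> ~ constant_on_torus f ->
  exists s t, forall x y, f (x + s) (y + t) = -1 * f x y.
Proof.
  intros (Hp & Hs & _ & mu & Hl) Hc.
  pose proof PI_RGT_0 as Hpi.
  assert (Hmu : mu <> 0).
  (* The circle of [mu = 0] is the origin, whose mode is invariant under all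
     translations. *)
  { intros E; apply Hc; exists (f 0 0); intros x y.
    pose proof (eigenfunction_translate f mu 1 x y Hp Hs Hl) as H.
    replace x with (0 + x) at 1 by ring; replace y with (0 + y) at 1 by ring.
    rewrite H; [ring|].
    intros m n Hmn; rewrite E in Hmn; exists 0%Z, 0%Z.
    assert (Z0 : IZR (m * m + n * n) = 0).
    { destruct (Rmult_integral _ _ (eq_sym Hmn)) as [A|A]; [|exact A].
      exfalso; revert A; apply pow_nonzero; lra. }
    apply eq_IZR in Z0.
    assert (m = 0%Z) by nia; assert (n = 0%Z) by nia; subst.
    repeat split; try ring. }
  destruct (excluded_middle_informative
    (exists l : Z, (0 < l)%Z /\ mu = (2 * PI) ^ 2 * IZR l)) as [[l [Hl0 El]]|N].
  - destruct (circle_half_turn l Hl0) as (s & t & H); exists s, t.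
    apply (eigenfunction_translate f mu); auto.
    intros m n Hmn.
    assert (Emn : (m * m + n * n = l)%Z).
    { apply eq_IZR, Rmult_eq_reg_l with ((2 * PI) ^ 2); [lra|].
      apply pow_nonzero; lra. }
    destruct (H m n Emn) as (j & k & Hj & Hk & Ho); exists j, k.
    repeat split; auto.
    unfold parity_sign; now rewrite <- Z.negb_odd, Ho.
  (* When no lattice point lies on the circle of [mu], the condition on the
     translation is vacuous. *)
  - exists 0, 0; apply (eigenfunction_translate f mu); auto.
    intros m n Hmn; exfalso; apply N; exists (m * m + n * n)%Z; split; [|exact Hmn].
    destruct (Z.eq_dec (m * m + n * n) 0) as [E|E]; [|nia].
    exfalso; apply Hmu; rewrite Hmn, E; ring.
Qed.

(** * Extrema *)

Lemma integer_translate_unit (x : R) : exists n : Z, 0 <= x + IZR n <= 1.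
Proof.
  exists (1 - up x)%Z; rewrite minus_IZR.
  pose proof (archimed x); lra.
Qed.

(** The maximum over [y] is a continuous function of [x] by uniform continuity,
    and is maximized in turn. *)
Lemma torus_maximum (f : R -> R -> R) :
  (forall x y, continuity_2d_pt f x y) -> on_torus f -> exists M, is_maximum f M.
Proof.
  intros Cf Hp.
  assert (HY : forall x, { y | forall v, 0 <= v <= 1 -> f x v <= f x y /\ 0 <= y <= 1 }).
  { intros x; apply constructive_indefinite_description.
    destruct (continuity_ab_maj (f x) 0 1) as [y [Hy Hy']]; [lra| |].
    - intros c _; apply continuity_pt_filterlim, continuity_2d_pt_snd, Cf.
    - exists y; auto. }
  (* [Y x] is a point of [[0, 1]] where [f x] is maximal. *)
  set (Y := fun x => proj1_sig (HY x)).
  assert (YM : forall x v, 0 <= v <= 1 -> f x v <= f x (Y x))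
    by (intros x v Hv; now apply (proj2_sig (HY x))).
  assert (YI : forall x, 0 <= Y x <= 1)
    by (intros x; apply (proj2_sig (HY x) 0); lra).
  destruct (continuity_ab_maj (fun x => f x (Y x)) 0 1) as [x0 [Hx0 _]]; [lra| |].
  - intros c _; apply continuity_pt_filterlim, filterlim_locally; intros eps.
    destruct (uniform_continuity_2d f (c - 1) (c + 1) 0 1 (fun x y _ _ => Cf x y) eps)
      as [d Hd].
    assert (d' : 0 < Rmin d 1) by (apply Rmin_glb_lt; [apply cond_pos | lra]).
    exists (mkposreal _ d'); intros u Hu.
    change (Rabs (u - c) < Rmin d 1) in Hu.
    change (Rabs (f u (Y u) - f c (Y c)) < eps).
    pose proof (Rmin_l d 1); pose proof (Rmin_r d 1).
    assert (Near : forall v, 0 <= v <= 1 -> Rabs (f u v - f c v) < eps).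
    { intros v Hv; pose proof (Rabs_def2 _ _ Hu).
      apply Hd; try lra.
      rewrite Rminus_diag, Rabs_R0; apply cond_pos. }
    pose proof (Rabs_def2 _ _ (Near (Y u) (YI u))).
    pose proof (Rabs_def2 _ _ (Near (Y c) (YI c))).
    pose proof (YM u (Y c) (YI c)); pose proof (YM c (Y u) (YI u)).
    apply Rabs_def1; lra.
  - exists (f x0 (Y x0)); split; [now exists x0, (Y x0)|].
    intros x y.
    destruct (integer_translate_unit x) as [m Hm].
    destruct (integer_translate_unit y) as [n Hn].
    rewrite <- (Hp m n x y).
    eapply Rle_trans; [apply YM, Hn | apply (Hx0 _ Hm)].
Qed.

Theorem theorem2p2 (psi : R -> R -> R)
    (psi_eigen : torus_eigenfunction psi)
    (psi_nonconstant : ~ constant_on_torus psi) :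
  exists M m : R, is_maximum psi M /\ is_minimum psi m /\ M = - m.
Proof.
  destruct (eigenfunction_antiperiod psi psi_eigen psi_nonconstant)
    as (s & t & H).
  destruct psi_eigen as (Hp & Hs & _).
  destruct (torus_maximum psi (fun x y => proj1 (Hs 0%nat x y)) Hp) as [M HM].
  exists M, (- M); split; [exact HM|]; split; [|ring].
  destruct HM as [(x & y & E) HM]; split.
  - exists (x + s), (y + t); rewrite H, E; ring.
  - intros u v; specialize (HM (u + s) (v + t)); rewrite H in HM; lra.
Qed.
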